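(* Let $(G/H,\varphi_i,\xi_i,\eta_i,g)$ be the homogeneous $3$-$(\alpha,\delta)$-Sasaki manifold over a Wolf space or its non-compact dual constructed from generalized $3$-Sasaki data $(G,G_0,H)$ as described in the context, with reductive decomposition $\mathfrak g=\mathfrak h\oplus\mathfrak m$, $\mathfrak m=\mathcal V\oplus\mathcal H$. The Levi-Civita connection of $g$ corresponds to the Nomizu map $$\Lambda^g_XY=\begin{cases}\frac12[X,Y]_{\mathfrak m} & X,Y\in\mathcal V\ \text{or}\ X,Y\in\mathcal H,\\ (1-\frac\alpha\delta)[X,Y] & X\in\mathcal V,\ Y\in\mathcal H,\\ \frac\alpha\delta[X,Y] & X\in\mathcal H,\ Y\in\mathcal V.\end{cases}$$
   Context: Generalized $3$-Sasaki data $(G,G_0,H)$: $G/G_0$ is a Riemannian symmetric space of compact or of non-compact type, with Lie algebra decomposition $\mathfrak g=\mathfrak g_0\oplus\mathfrak g_1$, $[\mathfrak g_i,\mathfrak g_j]\subset\mathfrak g_{i+j}$ (indices mod $2$); $H\subset G_0$ is a connected Lie subgroup with Lie algebra $\mathfrak h$ such that $\mathfrak g_0=\mathfrak h\oplus\mathfrak{sp}(1)$ as a direct sum of Lie algebras; and $\mathfrak g_1^{\mathbb C}=\mathbb C^2\otimes_{\mathbb C}W$ for some $\mathfrak h^{\mathbb C}$-module $W$ with $\dim_{\mathbb C}W=2n$, such that the adjoint action of $\mathfrak g_0^{\mathbb C}=\mathfrak h^{\mathbb C}\oplus\mathfrak{sp}(1)^{\mathbb C}$ on $\mathfrak g_1^{\mathbb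 C}$ is $(A,B)\cdot((z_1,z_2)\otimes w)=B(z_1,z_2)\otimes w+(z_1,z_2)\otimes Aw$, where $\mathfrak{sp}(1)^{\mathbb C}=\mathfrak{su}(2)^{\mathbb C}=\mathfrak{sl}(2,\mathbb C)$ acts on $\mathbb C^2$ by matrix multiplication. The homogeneous $3$-$(\alpha,\delta)$-Sasaki manifold: put $\mathcal V=\mathfrak{sp}(1)$, $\mathcal H=\mathfrak g_1$, $\mathfrak m=\mathcal V\oplus\mathcal H\cong T_{eH}(G/H)$. Let $\alpha,\delta\neq0$ be real with $\alpha\delta>0$ in the compact case and $\alpha\delta<0$ in the non-compact case. Let $\kappa$ be the Killing form of $\mathfrak g$. The $G$-invariant tensors on $G/H$ are determined by $g|_{\mathcal V}=\frac{-\kappa}{4\delta^2(n+2)}$, $g|_{\mathcal H}=\frac{-\kappa}{8\alpha\delta(n+2)}$, $\mathcal V\perp\mathcal H$; $\xi_i=\delta\sigma_i$ with $\sigma_1=\begin{pmatrix}i&0\\0&-i\end{pmatrix}$, $\sigma_2=\begin{pmatrix}0&-1\\1&0\end{pmatrix}$, $\sigma_3=\begin{pmatrix}0&-i\\-i&0\end{pmatrix}$ in $\mathfrak{sp}(1)=\mathfrak{su}(2)$; $\varphi_i|_{\mathcal V}=\frac1{2\delta}\mathrm{ad}\,\xi_i$, $\varphi_i|_{\mathcal H}=\frac1\delta\mathrm{ad}\,\xi_i$; $\eta_i=g(\xi_i,\cdot)$. Nomizu map: an invariant connection $\nabla$ on $G/H$ corresponds to the isotropy-equivariant bilinear map $\Lambda^\nabla\colon\mathfrak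 m\times\mathfrak m\to\mathfrak m$, $\Lambda^\nabla_XY=(\nabla_{\hat X}\hat Y-[\hat X,\hat Y])_o$, where $\hat X,\hat Y$ are the fundamental vector fields of $X,Y$, $[\hat X,\hat Y]$ is their commutator as vector fields, and $o=eH$; its torsion at $o$ is $\Lambda^\nabla_XY-\Lambda^\nabla_YX-[X,Y]_{\mathfrak m}$. In the claim $[\cdot,\cdot]$ is the bracket of $\mathfrak g$ and the subscript $\mathfrak m$ denotes projection along $\mathfrak h$. *)

(* Defs.v *)
From HB Require Import structures.
From mathcomp Require Import all_boot all_order all_algebra.
From mathcomp Require Import all_classical all_reals all_analysis.
From mathcomp Require Import complex.
Set Implicit Arguments.
Unset Strict Implicit.
Unset Printing Implicit Defensive.
Import Order.TTheory GRing.Theory Num.Theory numFieldNormedType.Exports.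
Local Open Scope classical_set_scope.
Local Open Scope complex_scope.
Local Open Scope ring_scope.

Record lieAlgebra (R : realType) := LieAlgebra {
  lie_space :> vectType R;
  br : lie_space -> lie_space -> lie_space;
  br_linearl : forall (a : R) X Y Z, br (a *: X + Y) Z = a *: br X Z + br Y Z;
  br_linearr : forall (a : R) X Y Z, br X (a *: Y + Z) = a *: br X Y + br X Z;
  br_alt : forall X, br X X = 0;
  br_jacobi : forall X Y Z,
    br X (br Y Z) + br Y (br Z X) + br Z (br X Y) = 0
}.

Definition ad (R : realType) (g : lieAlgebra R) (X : g) : 'End(g) :=
  linfun (br X).

Definition killing (R : realType) (g : lieAlgebra R) (X Y : g) : R :=
  \tr (passmx.mxof (vbasis fullv) (vbasis fullv) (ad X \o ad Y)%VF).

Definition br_sub (R : realType) (g : lieAlgebra R) (U V W : {vspace g}) :=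
  forall X Y, X \in U -> Y \in V -> br X Y \in W.

(** The complexification of a real vector space [V] is [V * V], where [(X, Y)]
    stands for [X + iY]. *)

Definition cscale (R : realType) (V : lmodType R) (c : R[i]) (u : V * V)
    : V * V :=
  (complex.Re c *: u.1 - complex.Im c *: u.2,
   complex.Re c *: u.2 + complex.Im c *: u.1).

Definition brC (R : realType) (g : lieAlgebra R) (u v : g * g) : g * g :=
  (br u.1 v.1 - br u.2 v.2, br u.1 v.2 + br u.2 v.1).

Definition inC (R : realType) (V : vectType R) (U : {vspace V}) (u : V * V) :=
  u.1 \in U /\ u.2 \in U.

Section su2.
Variable R : realType.

Definition adjmx (A : 'M[R[i]]_2) : 'M[R[i]]_2 := map_mx (@conjc R) A^T.

Definition su2 : set 'M[R[i]]_2 := [set A | adjmx A = - A /\ \tr A = 0].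

Definition mx2 (a b c d : R[i]) : 'M[R[i]]_2 :=
  \matrix_(i, j) if i == 0 then (if j == 0 then a else b)
                 else (if j == 0 then c else d).

Definition sigma (k : 'I_3) : 'M[R[i]]_2 :=
  if k == 0 then mx2 (Complex 0 1) 0 0 (- Complex 0 1)
  else if k == 1 then mx2 0 (- 1) 1 0
  else mx2 0 (- Complex 0 1) (- Complex 0 1) 0.

Definition isSu2Iso (g : lieAlgebra R) (V : {vspace g})
    (iota : 'M[R[i]]_2 -> g) :=
  [/\ forall (a : R) A B, su2 A -> su2 B ->
        iota (a%:C *: A + B) = a *: iota A + iota B,
      forall A B, su2 A -> su2 B ->
        iota (A *m B - B *m A) = br (iota A) (iota B),
      forall A B, su2 A -> su2 B -> iota A = iota B -> A = B
    & forall X, X \in V <-> exists2 A, su2 A & iota A = X].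

(** [sl(2,C) = su(2) + i su(2)] via [B = (B - B^* )/2 + i (B + B^* )/(2i)]. *)
Definition iotaC (g : lieAlgebra R) (iota : 'M[R[i]]_2 -> g) (B : 'M[R[i]]_2)
    : g * g :=
  (iota (2^-1 *: (B - adjmx B)), iota ((2 * (Complex 0 1))^-1 *: (B + adjmx B))).

End su2.

(** A Lie group enters through its underlying abstract group, its Lie algebra,
    its exponential map and its adjoint representation; every Lie group
    provides such a record.  The last field fixes the sign of the bracket: it
    is the bracket of left invariant vector fields. *)
Record lieGroup (R : realType) := LieGroup {
  lie_grp :> groupType;
  lie : lieAlgebra R;
  expG : lie -> lie_grp;
  Ad : lie_grp -> lie -> lie;
  expG_D : forall (s t : R) X,
    expG ((s + t) *: X) = (expG (s *: X) * expG (t *: X))%g;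
  expG_inj : forall X Y, (forall t : R, expG (t *: X) = expG (t *: Y)) -> X = Y;
  Ad_linear : forall a (c : R) X Y, Ad a (c *: X + Y) = c *: Ad a X + Ad a Y;
  Ad_expG : forall a X, expG (Ad a X) = (a * expG X * a^-1)%g;
  Ad_derive : forall (ell : {linear lie -> R^o}) X Y,
    is_derive (0 : R^o) 1 (fun t : R^o => ell (Ad (expG ((t : R) *: X)) Y))
              (ell (br X Y))
}.

Definition isSubgroup (G : groupType) (K : set G) :=
  [/\ K 1%g, forall a b, K a -> K b -> K (a * b)%g & forall a, K a -> K a^-1%g].

(** The subgroup generated by [expG k], i.e. the connected Lie subgroup with
    Lie algebra [k]. *)
Definition expGenerated (R : realType) (G : lieGroup R) (k : {vspace lie G})
    : set G :=
  [set a | forall K : set G, isSubgroup K ->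
     (forall X, X \in k -> K (expG X)) -> K a].

Definition lieOf (R : realType) (G : lieGroup R) (K : set G) : set (lie G) :=
  [set X | forall t : R, K (expG (t *: X))].

(** [(G, theta)] is a symmetric pair: [theta] is the involution whose
    differential is [1] on [g0] and [-1] on [g1], and [G0] lies between the
    fixed point group of [theta] and its identity component.  The tensor
    product [C^2 (x) W] is given by the bilinear map [tens]: since [e1, e2] is
    a basis of [C^2], every element is [e1 (x) w1 + e2 (x) w2] for unique
    [w1, w2]. *)
Record sasaki3Data (R : realType) (G : lieGroup R) (n : nat) := Sasaki3Data {
  G0 : set G;
  H : set G;
  theta : G -> G;
  g0 : {vspace lie G};
  g1 : {vspace lie G};
  h : {vspace lie G};
  sp1 : {vspace lie G};
  iota : 'M[R[i]]_2 -> lie G;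
  W : vectType R[i];
  rho : lie G * lie G -> W -> W;
  tens : 'cV[R[i]]_2 -> W -> lie G * lie G;

  g_decomp : (g0 + g1)%VS = fullv;
  g_direct : (g0 :&: g1)%VS = 0%VS;
  g_graded : [/\ br_sub g0 g0 g0, br_sub g0 g1 g1, br_sub g1 g0 g1
               & br_sub g1 g1 g0];
  thetaM : forall a b, theta (a * b)%g = (theta a * theta b)%g;
  thetaK : forall a, theta (theta a) = a;
  theta_exp : forall X0 X1, X0 \in g0 -> X1 \in g1 ->
    theta (expG (X0 + X1)) = expG (X0 - X1);
  G0_subgroup : isSubgroup G0;
  G0_fix : G0 `<=` [set a | theta a = a];
  G0_idcomp : expGenerated g0 `<=` G0;

  H_connected : H = expGenerated h;
  H_lie : lieOf H = [set X | X \in h];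
  H_sub : H `<=` G0;

  g0_decomp : (h + sp1)%VS = g0;
  g0_direct : (h :&: sp1)%VS = 0%VS;
  g0_lie : [/\ br_sub h h h, br_sub sp1 sp1 sp1 & br_sub h sp1 0%VS];
  sp1_iso : isSu2Iso sp1 iota;

  W_dim : \dim {:W} = (2 * n)%N;
  rho_linear : forall (c : R[i]) A w w',
    inC h A -> rho A (c *: w + w') = c *: rho A w + rho A w';
  rho_linearl : forall (c : R[i]) A B w, inC h A -> inC h B ->
    rho (cscale c A + B) w = c *: rho A w + rho B w;
  rho_br : forall A B w, inC h A -> inC h B ->
    rho (brC A B) w = rho A (rho B w) - rho B (rho A w);

  tens_linearl : forall (c : R[i]) z z' w,
    tens (c *: z + z') w = cscale c (tens z w) + tens z' w;
  tens_linearr : forall (c : R[i]) z w w',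
    tens z (c *: w + w') = cscale c (tens z w) + tens z w';
  tens_g1 : forall z w, inC g1 (tens z w);
  tens_iso : forall u, inC g1 u -> exists! w : W * W,
    u = tens (delta_mx 0 0) w.1 + tens (delta_mx 1 0) w.2;
  ad_tens : forall A B z w, inC h A -> \tr B = 0 ->
    brC (A + iotaC iota B) (tens z w) = tens (B *m z) w + tens z (rho A w)
}.

Section DataNotions.
Variables (R : realType) (G : lieGroup R) (n : nat) (D : sasaki3Data G n).

Definition compactType := forall X : lie G, X != 0 -> killing X X < 0.

Definition noncompactType :=
  (forall X, X \in g0 D -> X != 0 -> killing X X < 0) /\
  (forall X, X \in g1 D -> X != 0 -> 0 < killing X X).

Definition m : {vspace lie G} := (sp1 D + g1 D)%VS.

Definition pr_m (X : lie G) : lie G := daddv_pi m (h D) X.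

End DataNotions.

Fixpoint Ck (R : realType) (V : normedModType R) (k : nat) (u : V -> R^o)
    : Prop :=
  continuous u /\
  if k is k'.+1 then
    forall v : V, (forall x, derivable u x v) /\ Ck k' (fun x => 'D_v u x)
  else True.

(** The manifold [G/H]: a transitive [G]-set [pt] with base point [orig] of
    isotropy group [H], together with its algebra [Cinf] of smooth functions,
    evaluated at points by [ev].
    - [act_smooth]: the action is smooth, stated along pairs of one-parameter
      subgroups.
    - [fund X] is the fundamental vector field of [X], at [p] the velocity of
      [t |-> exp(tX) p]; it depends linearly on [X].
    - [tangent_orig], [fund_orig]: [X |-> fund X] at [orig] identifies [g/h] with the
      tangent space at [orig]. *)

Definition isTangent (R : realType) (C : comAlgType R)
    (evp : C -> R) (v : C -> R) :=
  (forall (a : R) f k, v (a *: f + k) = a * v f + v k) /\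
  (forall f k, v (f * k) = v f * evp k + evp f * v k).

Record homSpace (R : realType) (G : lieGroup R) (H : set G) := HomSpace {
  pt : Type;
  orig : pt;
  act : G -> pt -> pt;
  act1 : forall p, act 1%g p = p;
  actM : forall a b p, act (a * b)%g p = act a (act b p);
  act_trans : forall p, exists a, act a orig = p;
  act_stab : [set a | act a orig = orig] = H;

  Cinf : comAlgType R;
  ev : pt -> {lrmorphism Cinf -> R^o};
  ev_inj : forall f k, (forall p, ev p f = ev p k) -> f = k;

  transl : G -> Cinf -> Cinf;
  ev_transl : forall a f p, ev p (transl a f) = ev (act a p) f;
  act_smooth : forall f X Y p k,
    Ck k (fun st : R^o * R^o =>
      ev (act (expG ((st.1 : R) *: X) * expG ((st.2 : R) *: Y))%g p) f);

  fund : lie G -> Cinf -> Cinf;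
  fund_derive : forall X f p,
    is_derive (0 : R^o) 1 (fun t : R^o => ev (act (expG ((t : R) *: X)) p) f)
              (ev p (fund X f));
  fund_linear : forall (a : R) X Y f,
    fund (a *: X + Y) f = a *: fund X f + fund Y f;

  tangent_orig : forall v, isTangent (ev orig) v ->
    exists X, v = (fun f => ev orig (fund X f));
  fund_orig : forall X, (forall f, ev orig (fund X f) = 0) <-> lieOf H X
}.

Section HomSpaceGeometry.
Variables (R : realType) (G : lieGroup R) (H : set G) (M : homSpace H).
Local Notation C := (Cinf M).

Definition tangent (p : pt M) (v : C -> R) := isTangent (ev p) v.

Definition vectorField (V : C -> C) :=
  (forall (a : R) f k, V (a *: f + k) = a *: V f + V k) /\
  (forall f k, V (f * k) = V f * k + f * V k).

Definition at_pt (p : pt M) (V : C -> C) : C -> R := fun f => ev p (V f).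

Definition vbr (V W : C -> C) : C -> C := fun f => V (W f) - W (V f).

(** Push-forwards along the diffeomorphism [act a]. *)
Definition pushT (a : G) (v : C -> R) : C -> R := fun f => v (transl a f).
Definition pushV (a : G) (V : C -> C) : C -> C :=
  fun f => transl a^-1%g (V (transl a f)).

Definition metricField := pt M -> (C -> R) -> (C -> R) -> R.

Definition riemannian (gm : metricField) :=
  [/\ forall p (a : R) u v w, tangent p u -> tangent p v -> tangent p w ->
        gm p (fun f => a * u f + v f) w = a * gm p u w + gm p v w,
      forall p u v, tangent p u -> tangent p v -> gm p u v = gm p v u,
      forall p u, tangent p u -> u <> (fun _ => 0) -> 0 < gm p u u
    & forall V W, vectorField V -> vectorField W ->
        exists k : C, forall p, ev p k = gm p (at_pt p V) (at_pt p W)].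

Definition invariantMetric (gm : metricField) :=
  forall a p u v, tangent p u -> tangent p v ->
    gm (act a p) (pushT a u) (pushT a v) = gm p u v.

Definition connection (nabla : (C -> C) -> (C -> C) -> (C -> C)) :=
  [/\ forall V W, vectorField V -> vectorField W -> vectorField (nabla V W),
      forall (k : C) U V W, vectorField U -> vectorField V -> vectorField W ->
        forall f, nabla (fun f' => k * U f' + V f') W f
                  = k * nabla U W f + nabla V W f,
      forall (a : R) U V W, vectorField U -> vectorField V -> vectorField W ->
        forall f, nabla U (fun f' => a *: V f' + W f') f
                  = a *: nabla U V f + nabla U W f
    & forall (k : C) V W, vectorField V -> vectorField W ->
        forall f, nabla V (fun f' => k * W f') f
                  = V k * W f + k * nabla V W f].

Definition torsionFree (nabla : (C -> C) -> (C -> C) -> (C -> C)) :=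
  forall V W, vectorField V -> vectorField W ->
    forall f, nabla V W f - nabla W V f = vbr V W f.

Definition metricConnection (gm : metricField)
    (nabla : (C -> C) -> (C -> C) -> (C -> C)) :=
  forall U V W, vectorField U -> vectorField V -> vectorField W ->
    forall k : C, (forall p, ev p k = gm p (at_pt p V) (at_pt p W)) ->
    forall p, ev p (U k) = gm p (at_pt p (nabla U V)) (at_pt p W)
                           + gm p (at_pt p V) (at_pt p (nabla U W)).

Definition leviCivita (gm : metricField)
    (nabla : (C -> C) -> (C -> C) -> (C -> C)) :=
  [/\ connection nabla, torsionFree nabla & metricConnection gm nabla].

Definition invariantConnection (nabla : (C -> C) -> (C -> C) -> (C -> C)) :=
  forall a V W, vectorField V -> vectorField W ->
    forall f, pushV a (nabla V W) f = nabla (pushV a V) (pushV a W) f.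

(** The identification of [m] with the tangent space at [orig]. *)
Definition tan_orig (X : lie G) : C -> R := at_pt (orig M) (fund (h := M) X).

(** [Lam] is the Nomizu map of the invariant connection [nabla]; only its
    values on the reductive complement [m] matter. *)
Definition nomizuMap (m : {vspace lie G})
    (nabla : (C -> C) -> (C -> C) -> (C -> C)) (Lam : lie G -> lie G -> lie G) :=
  [/\ forall X Y, X \in m -> Y \in m -> Lam X Y \in m,
      forall (a : R) X Y Z, X \in m -> Y \in m -> Z \in m ->
        Lam (a *: X + Y) Z = a *: Lam X Z + Lam Y Z /\
        Lam Z (a *: X + Y) = a *: Lam Z X + Lam Z Y,
      forall a X Y, H a -> X \in m -> Y \in m ->
        Lam (Ad a X) (Ad a Y) = Ad a (Lam X Y)
    & forall X Y, X \in m -> Y \in m -> forall f,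
        tan_orig (Lam X Y) f
        = ev (orig M) (nabla (fund X) (fund Y) f) - ev (orig M) (vbr (fund X) (fund Y) f)].

End HomSpaceGeometry.

Arguments tan_orig {R G H} M X.

Record sasaki3Manifold (R : realType) (G : lieGroup R) (n : nat)
    (D : sasaki3Data G n) (alpha delta : R) (M : homSpace (H D)) :=
  Sasaki3Manifold {
  metric : metricField M;
  xi : 'I_3 -> Cinf M -> Cinf M;
  eta : 'I_3 -> pt M -> (Cinf M -> R) -> R;
  phi : 'I_3 -> pt M -> (Cinf M -> R) -> (Cinf M -> R);

  metric_riemannian : riemannian metric;
  metric_invariant : invariantMetric metric;
  metric_V : forall X Y, X \in sp1 D -> Y \in sp1 D ->
    metric (orig M) (tan_orig M X) (tan_orig M Y)
    = - killing X Y / (4 * delta ^+ 2 * (n%:R + 2));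
  metric_H : forall X Y, X \in g1 D -> Y \in g1 D ->
    metric (orig M) (tan_orig M X) (tan_orig M Y)
    = - killing X Y / (8 * alpha * delta * (n%:R + 2));
  metric_VH : forall X Y, X \in sp1 D -> Y \in g1 D ->
    metric (orig M) (tan_orig M X) (tan_orig M Y) = 0;

  xi_field : forall k, vectorField (xi k);
  xi_invariant : forall k a f, pushV a (xi k) f = xi k f;
  xi_orig : forall k, at_pt (orig M) (xi k) = tan_orig M (delta *: iota D (sigma R k));

  eta_def : forall k p v, tangent p v -> eta k p v = metric p (at_pt p (xi k)) v;

  phi_linear : forall k p (a : R) u v, tangent p u -> tangent p v ->
    phi k p (fun f => a * u f + v f) = (fun f => a * phi k p u f + phi k p v f);
  phi_tangent : forall k p u, tangent p u -> tangent p (phi k p u);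
  phi_smooth : forall k V, vectorField V ->
    exists2 V', vectorField V' & forall p, at_pt p V' = phi k p (at_pt p V);
  phi_invariant : forall k a p u, tangent p u ->
    phi k (act a p) (pushT a u) = pushT a (phi k p u);
  phi_V : forall k X, X \in sp1 D ->
    phi k (orig M) (tan_orig M X)
    = tan_orig M ((2 * delta)^-1 *: br (delta *: iota D (sigma R k)) X);
  phi_H : forall k X, X \in g1 D ->
    phi k (orig M) (tan_orig M X)
    = tan_orig M (delta^-1 *: br (delta *: iota D (sigma R k)) X)
}.

(* Main.v *)
Require Import Defs.
From HB Require Import structures.
From mathcomp Require Import all_boot all_order all_algebra.
From mathcomp Require Import all_classical all_reals all_analysis.
From mathcomp Require Import complex ring lra.
Set Implicit Arguments.
Unset Strict Implicit.
Unset Printing Implicit Defensive.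
Import Order.TTheory GRing.Theory Num.Theory numFieldNormedType.Exports.
Local Open Scope classical_set_scope.
Local Open Scope complex_scope.
Local Open Scope ring_scope.

(** The Levi-Civita connection is determined by the Koszul formula ([koszul]),
    whose terms are derivatives of the metric along vector fields and Lie
    brackets of vector fields.  Every element of [G] is an isometry, hence
    preserves these terms, and so the connection is invariant
    ([leviCivita_invariant]).

    On fundamental fields all these terms can be computed at the base point.
    Fundamental fields satisfy [vbr (fund X) (fund Y) = - fund [X, Y]]
    ([vbr_fund]; it rests on the symmetry of second derivatives, [derive_comm])
    and they are Killing fields ([fund_form_derive]).  Writing [B] for the
    symmetric form on the Lie algebra given by the metric at the base point, the
    Koszul formula becomes
      [2 B (Lam X Y, Z) = B ([X, Y], Z) + B ([Z, X], Y) + B (X, [Z, Y])]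
    ([nomizu_koszul]).  As the metric is definite on [m], this determines
    [Lam X Y] in [m].

    It remains to solve this equation.  [B] vanishes on [h], makes [sp(1)] and
    [g1] orthogonal, and is a multiple of the Killing form on each of them, with
    multiples in the ratio [2 alpha / delta] ([killing_coef_VH]).  If the two
    multiples were equal, invariance of the Killing form would cancel the last two terms
    and leave [Lam X Y = [X, Y]_m / 2].  In general these terms survive only for
    horizontal [Z] with one of [X], [Y] vertical and the other horizontal
    ([form_defect]), which yields the correction in [nomizu_formula].  Equality of
    [B] with a multiple of the Killing form on [g0] paired with [sp(1)] uses that
    [h] and [sp(1)] are orthogonal for the Killing form ([killing_h_sp1]).

    Equivariance under [H] follows from invariance of the connection once [m] is
    known to be stable under [Ad a] for [a] in [H] ([Ad_H_m]): [sp(1)] is fixed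
    pointwise, as it commutes with [h], and [g1] is preserved because [H] is
    fixed by the involution. *)

(** * Killing form *)

Section LieAlgebra.
Variables (R : realType) (g : lieAlgebra R).
Implicit Types X Y Z : g.

HB.instance Definition _ X :=
  GRing.isLinear.Build R g g _ (br X) (fun a Y Z => br_linearr a X Y Z).

Lemma br_add_l X Y Z : br (X + Y) Z = br X Z + br Y Z.
Proof. by have := br_linearl 1 X Y Z; rewrite !scale1r. Qed.

Lemma br_anti X Y : br X Y = - br Y X.
Proof.
apply/eqP; rewrite -addr_eq0; apply/eqP; have := br_alt (X + Y).
by rewrite br_add_l !linearD /= !br_alt add0r addr0.
Qed.

Lemma br_opp_l X Y : br (- X) Y = - br X Y.
Proof. by rewrite br_anti linearN /= opprK br_anti. Qed.

Lemma adE X Y : ad X Y = br X Y.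
Proof. by rewrite lfunE. Qed.

Lemma ad_linear : linear (@ad R g).
Proof.
by move=> a X Y; apply/lfunP => Z; rewrite add_lfunE scale_lfunE !adE br_linearl.
Qed.

HB.instance Definition _ := GRing.isLinear.Build R g _ _ (@ad R g) ad_linear.

Lemma ad_br X Y : ad (br X Y) = (ad X \o ad Y)%VF - (ad Y \o ad X)%VF.
Proof.
apply/lfunP => Z; rewrite add_lfunE opp_lfunE !comp_lfunE !adE.
have /eqP := br_jacobi X Y Z; rewrite addr_eq0 => /eqP E.
by rewrite [LHS]br_anti -E (br_anti Z X) linearN.
Qed.

Definition endo_trace (f : 'End(g)) : R :=
  \tr (passmx.mxof (vbasis fullv) (vbasis fullv) f).

Lemma endo_trace_linear : linear_for *%R endo_trace.
Proof. by move=> a f k; rewrite /endo_trace passmx.mxof_linear mxtraceD mxtraceZ. Qed.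

HB.instance Definition _ :=
  GRing.isLinear.Build R _ _ _ endo_trace endo_trace_linear.

Lemma endo_traceC (f k : 'End(g)) :
  endo_trace (f \o k)%VF = endo_trace (k \o f)%VF.
Proof.
rewrite /endo_trace !(passmx.mxof_comp _ _ (vbasisP (@fullv _ g))).
exact: mxtrace_mulC.
Qed.

Lemma killingE X Y : killing X Y = endo_trace (ad X \o ad Y)%VF.
Proof. by []. Qed.

Lemma killing_sym X Y : killing X Y = killing Y X.
Proof. exact: endo_traceC. Qed.

Lemma killing_add_l X Y Z : killing (X + Y) Z = killing X Z + killing Y Z.
Proof. by rewrite !killingE linearD comp_lfunDl linearD. Qed.

Lemma killing_scale_l a X Y : killing (a *: X) Y = a * killing X Y.
Proof. by rewrite !killingE linearZ /= -comp_lfunZl linearZ. Qed.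

Lemma killing_0_l X : killing (0 : g) X = 0.
Proof. by rewrite killingE linear0 comp_lfun0l linear0. Qed.

Lemma killing_opp_l X Y : killing (- X) Y = - killing X Y.
Proof. by rewrite !killingE linearN comp_lfunNl linearN. Qed.

(** With [ad [X, Y] = ad X o ad Y - ad Y o ad X], both sides expand to traces of
    triple products that agree up to cyclic permutation. *)
Lemma killing_invariant X Y Z : killing (br X Y) Z = killing X (br Y Z).
Proof.
rewrite !killingE !ad_br comp_lfunDl comp_lfunDr comp_lfunNl comp_lfunNr.
rewrite !linearB /= comp_lfunA; congr (_ - _).
by rewrite -comp_lfunA endo_traceC comp_lfunA.
Qed.

End LieAlgebra.

(** * Second derivatives along lines *)

Section Calculus.
Variable R : realType.

Lemma is_derive_unique (f : R^o -> R^o) (x v : R^o) (d d' : R^o) :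
  is_derive x v f d -> is_derive x v f d' -> d = d'.
Proof. by case=> _ <- [_ <-]. Qed.

Lemma is_derive_line (V : normedModType R) (u : V -> R^o) (y v : V) (t : R) :
  derivable u (y + t *: v) v ->
  is_derive (t : R^o) 1 (fun s : R^o => u (y + (s : R) *: v)) ('D_v u (y + t *: v)).
Proof.
move=> du.
suff E : (fun h : R => h^-1 *: (((fun s : R^o => u (y + (s : R) *: v)) \o shift (t : R^o))
             (h *: (1 : R^o)) - u (y + t *: v)))
         = (fun h : R => h^-1 *: ((u \o shift (y + t *: v)) (h *: v) - u (y + t *: v))).
  by split; [rewrite /derivable E | rewrite /derive E].
apply/funext => h /=; congr (_ *: (u _ - _)).
rewrite [h *: 1 in LHS]mulr1 scalerDl addrCA; congr (_ + _).
Qed.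

Lemma mvt_line (f df : R -> R) (a : R) : 0 < a ->
  (forall x, is_derive (x : R^o) 1 (f : R^o -> R^o) (df x)) ->
  exists2 c, 0 <= c <= a & f a - f 0 = df c * a.
Proof.
move=> a0 fd; have [|c cin E] := @MVT R f df 0 a a0 (fun x _ => fd x).
  apply: continuous_subspaceT => x; apply: differentiable_continuous.
  by apply/derivable1_diffP; case: (fd x).
exists c; last by rewrite E subr0.
by move: cin; rewrite in_itv /= => /andP[/ltW -> /ltW ->].
Qed.

(** Only the quadrant of nonnegative parameters matters: it contains the
    intermediate points that the mean value theorem returns. *)
Lemma continuous_parallelogram (V : normedModType R) (A : V -> R^o) (x v w : V)
    (e : R) : {for x, continuous A} -> 0 < e ->
  exists2 d : R, 0 < d & forall s t, 0 <= s <= d -> 0 <= t <= d ->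
    `|A x - A (x + s *: v + t *: w)| < e.
Proof.
move=> cA e0.
pose F (z : R^o * R^o) : V := x + (z.1 : R) *: v + (z.2 : R) *: w.
have F0 : F 0 = x by rewrite /F /= !scale0r !addr0.
have cF : {for 0, continuous F}.
  apply: continuousD.
    apply: continuousD; first exact: cvg_cst.
    by apply: cvgZr_tmp; exact: cvg_fst.
  by apply: cvgZr_tmp; exact: cvg_snd.
have : {for 0, continuous (A \o F)} by apply: continuous_comp => //; rewrite F0.
move/cvgrPdist_lt => /(_ e e0) /nbhs_ballP [d /= d0 dP].
exists (d / 2); first by rewrite divr_gt0.
move=> s t /andP[s0 sd] /andP[t0 td].
have := dP (s, t); rewrite /F /= !scale0r !addr0; apply.
by split; rewrite /ball /= sub0r normrN ger0_norm //; lra.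
Qed.

Lemma eq_of_second_difference (a b c k p q d : R) : 0 < d ->
  a - b - (c - k) = p * d * d -> a - c - (b - k) = q * d * d -> p = q.
Proof.
move=> /lt0r_neq0 d0 pE qE; apply: (mulIf d0); apply: (mulIf d0).
by rewrite -pE -qE; ring.
Qed.

Lemma dist_le_of_close (a b p q e : R) :
  p = q -> `|a - q| < e / 2 -> `|b - p| < e / 2 -> `|a - b| <= e.
Proof.
move=> -> aq bq; rewrite -(subrKA q) (le_trans (ler_normD _ _)) //.
by rewrite (distrC q b); lra.
Qed.

(** Clairaut and Schwarz: two applications of the mean value theorem write the
    second difference of [u] over the parallelogram with sides [d *: v] and
    [d *: w], divided by [d ^+ 2], as a value of either iterated derivative at
    some point of the parallelogram.  Let the parallelogram shrink to [x]. *)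
Lemma derive_comm (V : normedModType R) (u : V -> R^o) (x v w : V) :
  Ck 2 u -> 'D_v (fun y => 'D_w u y) x = 'D_w (fun y => 'D_v u y) x.
Proof.
move=> [_ C2].
have [dv [_ C1v]] := C2 v; have [dw [_ C1w]] := C2 w.
have [dvw [cvw _]] := C1v w; have [dwv [cwv _]] := C1w v.
apply/eqP; rewrite -subr_eq0 -normr_le0; apply/ler_addgt0Pl => e e0.
rewrite addr0.
have e2 : 0 < e / 2 by rewrite divr_gt0.
have [d1 d10 P1] := continuous_parallelogram v w (cwv x) e2.
have [d2 d20 P2] := continuous_parallelogram v w (cvw x) e2.
pose d := Num.min d1 d2.
have d0 : 0 < d by rewrite lt_min d10.
have mean (a b : V) : (forall y, derivable u y a) ->
    (forall y, derivable (fun y => 'D_a u y) y b) ->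
    exists st : R * R, [/\ 0 <= st.1 <= d, 0 <= st.2 <= d &
      u (x + d *: a + d *: b) - u (x + d *: a) - (u (x + d *: b) - u x)
      = 'D_b (fun y => 'D_a u y) (x + st.1 *: a + st.2 *: b) * d * d].
  move=> da dab.
  have [|s sd Es] := @mvt_line (fun s => u (x + d *: b + s *: a) - u (x + s *: a))
    (fun s => 'D_a u (x + d *: b + s *: a) - 'D_a u (x + s *: a)) d d0.
    move=> s; apply: is_deriveB; exact: is_derive_line.
  have [|t td Et] := @mvt_line (fun t => 'D_a u (x + s *: a + t *: b))
    (fun t => 'D_b (fun y => 'D_a u y) (x + s *: a + t *: b)) d d0.
    move=> t; exact: (@is_derive_line _ (fun y => 'D_a u y)).
  exists (s, t); split=> //=; rewrite -Et.
  move: Es; rewrite !scale0r !addr0 (addrAC x (d *: b)) (addrAC x (d *: b) (s *: a)).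
  by move=> ->.
have [[s t] /= [sd td E1]] := mean v w dv dvw.
have [[t' s'] /= [t'd s'd E2]] := mean w v dw dwv.
have le_d1 r : 0 <= r <= d -> 0 <= r <= d1.
  by rewrite /d le_min => /and3P[-> ->].
have le_d2 r : 0 <= r <= d -> 0 <= r <= d2.
  by rewrite /d le_min => /and3P[-> _ ->].
have hB := P2 _ _ (le_d2 _ sd) (le_d2 _ td).
have hA := P1 _ _ (le_d1 _ s'd) (le_d1 _ t'd).
rewrite (addrAC x (d *: w)) (addrAC x (t' *: w)) in E2.
exact: dist_le_of_close (eq_of_second_difference d0 E1 E2) hA hB.
Qed.

End Calculus.

(** * Curves in finite dimensional spaces *)

Section Curves.
Variables (R : realType) (V : vectType R).

Definition functional (f : V -> R) (lin : linear_for *%R f) : {linear V -> R^o} :=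
  HB.pack (f : V -> R^o) (GRing.isLinear.Build R V R^o *:%R f lin).

(** The derivative at [0] of a curve in a finite dimensional space, tested on
    linear functionals: this way the space needs no topology. *)
Definition curve_derive (c : R -> V) (c' : V) :=
  forall ell : {linear V -> R^o},
    is_derive (0 : R^o) 1 (fun t : R^o => ell (c t)) (ell c').

Lemma functional_expand (ell : {linear V -> R^o}) v :
  ell v = \sum_i coord (vbasis fullv) i v * ell (vbasis fullv)`_i.
Proof.
rewrite {1}(coord_vbasis (memvf v)) linear_sum; apply: eq_bigr => i _.
exact: linearZ.
Qed.

(** The product rule for a functional and a vector that both depend on time:
    expand the vector in a basis and differentiate the finite sum of products. *)
Lemma derive_pairing (c : R -> V) (c' : V) (F : R -> {linear V -> R^o})
    (F' : {linear V -> R^o}) :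
  curve_derive c c' ->
  (forall v, is_derive (0 : R^o) 1 (fun t : R^o => F t v) (F' v)) ->
  is_derive (0 : R^o) 1 (fun t : R^o => F t (c t)) (F 0 c' + F' (c 0)).
Proof.
move=> dc dF.
have -> : (fun t : R^o => F t (c t)) =
  \sum_i (fun t : R^o => (coord (vbasis fullv) i (c t) : R^o) * F t (vbasis fullv)`_i).
  by apply/funext => t; rewrite fct_sumE functional_expand.
apply: is_derive_eq.
  apply: is_derive_sum => i; apply: is_deriveM.
  exact: (dc (functional (linearP (coord (vbasis fullv) i)))).
rewrite (functional_expand (F 0)) (functional_expand F') -big_split /=.
by apply: eq_bigr => i _; rewrite addrC; congr (_ + _); rewrite /GRing.scale /= mulrC.
Qed.

End Curves.

(** * Adjoint representation *)

Section AdjointRepresentation.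
Variables (R : realType) (G : lieGroup R).
Implicit Types (a b : G) (X Y : lie G).

HB.instance Definition _ a :=
  GRing.isLinear.Build R (lie G) (lie G) _ (Ad a) (Ad_linear a).

Lemma AdM a b X : Ad (a * b)%g X = Ad a (Ad b X).
Proof.
apply: expG_inj => t; rewrite -!linearZ /= !Ad_expG invgM.
by rewrite !mulgA.
Qed.

Lemma Ad1 X : Ad 1%g X = X.
Proof. by apply: expG_inj => t; rewrite -linearZ /= Ad_expG invg1 mul1g mulg1. Qed.

Lemma AdVK a : cancel (Ad a) (Ad a^-1%g).
Proof. by move=> X; rewrite -AdM mulVg Ad1. Qed.

Lemma AdKV a : cancel (Ad a^-1%g) (Ad a).
Proof. by move=> X; rewrite -AdM mulgV Ad1. Qed.

Lemma expG0 : expG (0 : lie G) = 1%g.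
Proof.
have := expG_D 0 0 (0 : lie G); rewrite !scaler0.
by move/(congr1 (fun b => (expG 0)^-1 * b)%g); rewrite mulKg mulVg.
Qed.

Lemma expGN X : expG (- X) = (expG X)^-1%g.
Proof.
apply: (mulgI (expG X)); rewrite mulgV -expG0.
by have := expG_D 1 (-1) X; rewrite subrr scale0r scaleN1r scale1r => <-.
Qed.

Lemma Ad_curve X Y : curve_derive (fun t => Ad (expG (t *: X)) Y) (br X Y).
Proof. by move=> ell; exact: Ad_derive. Qed.

Lemma Ad_curveV X Y :
  curve_derive (fun t => Ad (expG (t *: X))^-1%g Y) (- br X Y).
Proof.
move=> ell; rewrite -br_opp_l; have := Ad_curve (- X) Y ell.
by congr is_derive; apply/funext => t; rewrite scalerN expGN.
Qed.

(** By the one-parameter group law, the derivative of [Ad (exp tX) Y] at any [t]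
    is that of [Ad (exp sX)] at [s = 0] followed by the linear map
    [Ad (exp tX)]; it is [Ad (exp tX) [X, Y] = 0]. *)
Lemma Ad_exp_fix X Y : br X Y = 0 -> Ad (expG X) Y = Y.
Proof.
move=> XY0.
suff const (ell : {linear lie G -> R^o}) : ell (Ad (expG X) Y) = ell Y.
  rewrite (coord_vbasis (memvf (Ad _ _))) [RHS](coord_vbasis (memvf Y)).
  apply: eq_bigr => i _; congr (_ *: _).
  exact: (const (functional (linearP (coord (vbasis fullv) i)))).
have := @is_derive_0_is_cst R (fun t => ell (Ad (expG (t *: X)) Y)) 1 0.
rewrite scale1r scale0r expG0 Ad1; apply => t.
have ellAd_lin : linear_for *%R (fun Z => ell (Ad (expG (t *: X)) Z) : R).
  by move=> c Z Z'; rewrite !linearP.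
have := Ad_curve X Y (functional ellAd_lin); rewrite XY0 linear0.
case=> [d0 e0].
have E : (fun h : R => h^-1 *: (((fun s : R^o => ell (Ad (expG ((s : R) *: X)) Y)) \o
              shift (t : R^o)) (h *: (1 : R^o)) - ell (Ad (expG (t *: X)) Y)))
  = (fun h : R => h^-1 *: (((fun s : R^o =>
       functional ellAd_lin (Ad (expG ((s : R) *: X)) Y)) \o shift (0 : R^o))
         (h *: (1 : R^o)) - functional ellAd_lin (Ad (expG (0 *: X)) Y))).
  apply/funext => h /=; rewrite scale0r expG0 Ad1; congr (_ *: (ell _ - _)).
  by rewrite -AdM -expG_D addr0 addrC.
by split; [rewrite /derivable E | rewrite /derive E].
Qed.

End AdjointRepresentation.

(** * Vector fields on a homogeneous space *)

Section VectorFields.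
Variables (R : realType) (G : lieGroup R) (H : set G) (M : homSpace H).
Local Notation C := (Cinf M).
Local Notation fundM := (fund (h := M)).
Implicit Types (X Y Z : lie G) (a b : G) (f k : C) (U V W : C -> C) (p : pt M).

Lemma evM p f k : ev p (f * k) = (ev p f : R) * ev p k.
Proof. exact: (rmorphM (ev p)). Qed.

Lemma evP p (c : R) f k : ev p (c *: f + k) = c * (ev p f : R) + ev p k.
Proof. exact: (linearP (ev p)). Qed.

Lemma evD p f k : ev p (f + k) = (ev p f : R) + ev p k.
Proof. exact: (raddfD (ev p)). Qed.

Lemma evB p f k : ev p (f - k) = (ev p f : R) - ev p k.
Proof. exact: (raddfB (ev p)). Qed.

Lemma at_pt_eq V W : (forall p, at_pt p V = at_pt p W) -> V = W.
Proof.
by move=> VW; apply/funext => f; apply: ev_inj => p; exact: (congr1 (@^~ f) (VW p)).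
Qed.

Lemma vfieldD V f k : vectorField V -> V (f + k) = V f + V k.
Proof. by case=> lin _; have := lin 1 f k; rewrite !scale1r. Qed.

Lemma vfield_tangent p V : vectorField V -> tangent p (at_pt p V).
Proof.
case=> lin leib; split=> [c f k | f k]; rewrite /at_pt ?lin ?leib.
  exact: evP.
by rewrite evD !evM.
Qed.

Lemma vfield_comb U V (c : C) :
  vectorField U -> vectorField V -> vectorField (fun f => c * U f + V f).
Proof.
move=> [Ul Um] [Vl Vm]; split=> [r f k | f k].
  by rewrite Ul Vl mulrDr scalerDr -scalerAr addrACA.
by rewrite Um Vm; ring.
Qed.

Lemma vbr_field U V : vectorField U -> vectorField V -> vectorField (vbr U V).
Proof.
move=> UU VV; have [Ul Um] := UU; have [Vl Vm] := VV.
split=> [r f k | f k]; rewrite /vbr.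
  by rewrite Vl Ul Ul Vl scalerBr opprD addrACA.
rewrite Vm Um (vfieldD _ _ UU) (vfieldD _ _ VV) !Um !Vm; ring.
Qed.

Lemma vfieldB U V :
  vectorField U -> vectorField V -> vectorField (fun f => U f - V f).
Proof.
move=> UU VV; have := vfield_comb (-1) VV UU; congr vectorField.
by apply/funext => f; rewrite mulN1r addrC.
Qed.

Lemma transl_rmorph a :
  [/\ forall (c : R) f k, transl a (c *: f + k) = c *: transl a f + transl a k,
      forall f k, transl a (f * k) = transl a f * transl a k
    & forall f, transl a^-1%g (transl a f) = f].
Proof.
split=> [c f k | f k | f]; apply: ev_inj => p.
- by rewrite evP !ev_transl evP.
- by rewrite evM !ev_transl evM.
- by rewrite !ev_transl -actM mulgV act1.
Qed.

Lemma translVK a f : transl a (transl a^-1%g f) = f.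
Proof. by have [_ _] := transl_rmorph a^-1%g; rewrite invgK; apply. Qed.

Lemma pushV_field a V : vectorField V -> vectorField (pushV a V).
Proof.
move=> [Vl Vm]; have [tl tm _] := transl_rmorph a.
have [tl' tm' tK] := transl_rmorph a^-1%g; have [_ _ tK'] := transl_rmorph a.
split=> [c f k | f k]; rewrite /pushV.
  by rewrite tl Vl tl'.
have tD (g l : C) : transl a^-1%g (g + l) = transl a^-1%g g + transl a^-1%g l.
  by have := tl' 1 g l; rewrite !scale1r.
by rewrite tm Vm tD !tm' !tK'.
Qed.

Lemma pushVK a V : pushV a^-1%g (pushV a V) = V.
Proof.
apply/funext => f; rewrite /pushV invgK translVK.
by have [_ _ tK] := transl_rmorph a^-1%g; rewrite translVK.
Qed.

Lemma pushVKV a V : pushV a (pushV a^-1%g V) = V.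
Proof. by have := pushVK a^-1%g V; rewrite invgK. Qed.

Lemma at_pt_push a p V : at_pt (act a p) (pushV a V) = pushT a (at_pt p V).
Proof.
by apply/funext => f; rewrite /at_pt /pushV /pushT ev_transl -actM mulVg act1.
Qed.

Lemma pushV_vbr a V W : pushV a (vbr V W) = vbr (pushV a V) (pushV a W).
Proof.
have [tl _ _] := transl_rmorph a^-1%g.
apply/funext => f; rewrite /pushV /vbr !translVK -scaleN1r addrC tl.
by rewrite scaleN1r addrC.
Qed.

Lemma fund_field X : vectorField (fundM X).
Proof.
split=> [c f k | f k]; apply: ev_inj => p.
  apply: is_derive_unique (fund_derive X (c *: f + k) p) _.
  rewrite evP.
  have -> : (fun t : R^o => ev (act (expG (t *: X)) p) (c *: f + k)) =
    (c \*: (fun t : R^o => ev (act (expG (t *: X)) p) f))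
    + (fun t : R^o => ev (act (expG (t *: X)) p) k).
    by apply/funext => t; rewrite evP.
  by apply: is_deriveD; [apply: is_deriveZ|]; exact: fund_derive.
apply: is_derive_unique (fund_derive X (f * k) p) _.
have -> : (fun t : R^o => ev (act (expG (t *: X)) p) (f * k)) =
  (fun t : R^o => ev (act (expG (t *: X)) p) f)
  * (fun t : R^o => ev (act (expG (t *: X)) p) k).
  by apply/funext => t; rewrite evM.
apply: is_derive_eq.
  by apply: is_deriveM; exact: fund_derive.
rewrite /= scale0r expG0 act1 evD !evM addrC.
by congr (_ + _); rewrite [LHS]mulrC.
Qed.

(** The curves [exp (t Ad a X) p] and [a exp (tX) a^-1 p] coincide. *)
Lemma fund_push a X : fundM (Ad a X) = pushV a (fundM X).
Proof.
apply/funext => f; apply: ev_inj => p.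
apply: is_derive_unique (fund_derive (Ad a X) f p) _.
rewrite /pushV ev_transl; have := fund_derive X (transl a f) (act a^-1%g p).
congr is_derive; apply/funext => t.
by rewrite ev_transl -linearZ /= Ad_expG !actM.
Qed.

Lemma fund_push_at a X p :
  at_pt (act a p) (fundM (Ad a X)) = pushT a (at_pt p (fundM X)).
Proof. by rewrite fund_push at_pt_push. Qed.

End VectorFields.

(** * Brackets of fundamental fields *)

Section FundamentalBracket.
Variables (R : realType) (G : lieGroup R) (H : set G) (M : homSpace H).
Local Notation fundM := (fund (h := M)).

Lemma fund_functional (f : Cinf M) (p : pt M) :
  linear_for *%R (fun Z : lie G => ev p (fundM Z f) : R).
Proof. by move=> c X Y; rewrite fund_linear evP. Qed.

(** The function of [t] is itself the derivative in [s], at [s = 0], of the smooth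
    function [u (t, s) = f (exp (tX) exp (sZ) p)].  Differentiating in [t] first instead
    gives [fund X f] along [exp (sZ) p], so the claim is the symmetry of the
    second derivatives of [u]. *)
Lemma fund_translate_derive (X Z : lie G) (f : Cinf M) (p : pt M) :
  is_derive (0 : R^o) 1
    (fun t : R^o => ev p (fundM Z (transl (expG (t *: X)) f)))
    (ev p (fundM Z (fundM X f))).
Proof.
have line1 (t s r : R) : (t, s) + r *: (1, 0) = (t + r, s) :> R^o * R^o.
  by congr pair; rewrite /= ?[_ *: 1]mulr1 ?[_ *: 0]mulr0 ?addr0.
have line2 (t s r : R) : (t, s) + r *: (0, 1) = (t, s + r) :> R^o * R^o.
  by congr pair; rewrite /= ?[_ *: 1]mulr1 ?[_ *: 0]mulr0 ?addr0.
pose u (st : R^o * R^o) : R^o :=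
  ev (act (expG ((st.1 : R) *: X) * expG ((st.2 : R) *: Z))%g p) f.
have u2 : Ck 2 u := act_smooth f X Z p 2.
have [_ /= du] := u2.
have [d1 [_ dd1]] := du (1, 0); have [d2 [_ dd2]] := du (0, 1).
have uX s : 'D_(1, 0) u (0, s) = ev (act (expG (s *: Z)) p) (fundM X f).
  apply/esym/(is_derive_unique (fund_derive X f (act (expG (s *: Z)) p))).
  have := is_derive_line (t := 0) (d1 ((0, s) + 0 *: (1, 0))).
  rewrite scale0r addr0; congr is_derive; apply/funext => t.
  by rewrite line1 /u /= add0r -actM.
have uZ t : 'D_(0, 1) u (t, 0) = ev p (fundM Z (transl (expG (t *: X)) f)).
  apply/esym/(is_derive_unique (fund_derive Z (transl (expG (t *: X)) f) p)).
  have := is_derive_line (t := 0) (d2 ((t, 0) + 0 *: (0, 1))).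
  rewrite scale0r addr0; congr is_derive; apply/funext => s.
  by rewrite line2 /u /= add0r ev_transl -actM.
have DXZ : 'D_(0, 1) (fun y => 'D_(1, 0) u y) (0, 0) = ev p (fundM Z (fundM X f)).
  apply/esym/(is_derive_unique (fund_derive Z (fundM X f) p)).
  have := is_derive_line (t := 0) ((dd1 (0, 1)).1 ((0, 0) + 0 *: (0, 1))).
  rewrite scale0r addr0; congr is_derive; apply/funext => s.
  by rewrite line2 add0r -uX.
rewrite -DXZ (derive_comm _ _ _ u2).
have := is_derive_line (t := 0) ((dd2 (1, 0)).1 ((0, 0) + 0 *: (1, 0))).
rewrite scale0r addr0; congr is_derive; apply/funext => t.
by rewrite line1 add0r -uZ.
Qed.

(** Write [fund Y f] at [exp (tX) p] as the value at [p] of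
    [fund (Ad (exp tX)^-1 Y)] on the translate of [f] by [exp (tX)].  By the
    product rule its derivative at [t = 0] is
    [fund (- [X, Y]) f + fund Y (fund X f)] at [p]. *)
Lemma vbr_fund (X Y : lie G) : vbr (fundM X) (fundM Y) = fundM (- br X Y).
Proof.
apply/funext => f; apply: ev_inj => p.
pose F t := functional (fund_functional (transl (expG (t *: X)) f) p).
pose F' := functional (fund_functional (fundM X f) p).
have := derive_pairing (F := F) (F' := F') (Ad_curveV X Y)
  (fun Z => fund_translate_derive X Z f p).
have -> : (fun t : R^o => F t (Ad (expG (t *: X))^-1%g Y)) =
          (fun t : R^o => ev (act (expG (t *: X)) p) (fundM Y f)).
  apply/funext => t; rewrite /F /= fund_push /pushV invgK ev_transl.
  by have [_ _ ->] := transl_rmorph M (expG (t *: X)).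
move/(is_derive_unique (fund_derive X (fundM Y f) p)).
rewrite /F /F' /= scale0r expG0 invg1 Ad1 => E.
rewrite /vbr evB E /=.
have -> : transl 1%g f = f by apply: ev_inj => q; rewrite ev_transl act1.
by rewrite addrK.
Qed.

End FundamentalBracket.

(** * Invariant metrics and the Koszul formula *)

Section RiemannianGeometry.
Variables (R : realType) (G : lieGroup R) (H : set G) (M : homSpace H).
Variable gm : metricField M.
Hypothesis gm_riem : riemannian gm.
Local Notation C := (Cinf M).
Local Notation fundM := (fund (h := M)).
Local Notation vf := (@vectorField R G H M).
Local Notation gmf p U V := (gm p (at_pt p U) (at_pt p V)).
Implicit Types (U V W : C -> C) (p : pt M).

Lemma gmf_sym p U V : vf U -> vf V -> gmf p U V = gmf p V U.
Proof. by move=> UU VV; have [_ + _ _] := gm_riem; apply; exact: vfield_tangent. Qed.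

Lemma gmfB p U V W : vf U -> vf V -> vf W ->
  gm p (fun f => at_pt p U f - at_pt p V f) (at_pt p W) = gmf p U W - gmf p V W.
Proof.
move=> UU VV WW; have [lin _ _ _] := gm_riem.
have := lin p (-1) (at_pt p V) (at_pt p U) (at_pt p W) (vfield_tangent p VV)
  (vfield_tangent p UU) (vfield_tangent p WW).
rewrite mulN1r addrC => <-; congr gm.
by apply/funext => f; rewrite mulN1r addrC.
Qed.

Lemma gm_nondegenerate p u : tangent p u -> gm p u u = 0 -> u = fun=> 0.
Proof.
move=> Tu u0; have [_ _ pos _] := gm_riem.
by apply: contrapT => /(pos p u Tu); rewrite u0 ltxx.
Qed.

(** Test against the difference of the two fields: it is itself a vector field, so
    definiteness applies at every point. *)
Lemma vfield_ext U V : vf U -> vf V ->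
  (forall p W, vf W -> gmf p U W = gmf p V W) -> U = V.
Proof.
move=> UU VV UV; apply: at_pt_eq => p; have WW := vfieldB UU VV.
have : gmf p (fun f => U f - V f) (fun f => U f - V f) = 0.
  rewrite -[LHS]/(gm p (at_pt p (fun f => U f - V f)) _).
  have -> : at_pt p (fun f => U f - V f) = (fun f => at_pt p U f - at_pt p V f).
    by apply/funext => f; rewrite /at_pt evB.
  (* the second argument is folded back: linearity is used in the first only *)
  rewrite -[X in gm p _ X](_ : at_pt p (fun f => U f - V f) = _); last first.
    by apply/funext => f; rewrite /at_pt evB.
  by rewrite gmfB // UV // subrr.
move/(gm_nondegenerate (vfield_tangent p WW)) => E; apply/funext => f.
by have /(congr1 (@^~ f)) := E; rewrite /at_pt evB => /eqP; rewrite subr_eq0 => /eqP.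
Qed.

Section LeviCivita.
Variable nabla : (C -> C) -> (C -> C) -> (C -> C).
Hypothesis nabla_LC : leviCivita gm nabla.

Lemma nabla_field V W : vf V -> vf W -> vf (nabla V W).
Proof. by have [[+ _ _ _] _ _] := nabla_LC; apply. Qed.

Lemma gmf_torsion p U V W : vf U -> vf V -> vf W ->
  gmf p (nabla U V) W - gmf p (nabla V U) W = gmf p (vbr U V) W.
Proof.
move=> UU VV WW; have [_ tf _] := nabla_LC.
rewrite -gmfB //; try exact: nabla_field.
by congr gm; apply/funext => f; rewrite /at_pt -tf // evB.
Qed.

(** The values of the metric on two fields enter through smooth functions that
    represent them, since vector fields are derivations of smooth functions. *)
Lemma koszul p U V W (kVW kUW kUV : C) : vf U -> vf V -> vf W ->
  (forall q, ev q kVW = gmf q V W) -> (forall q, ev q kUW = gmf q U W) ->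
  (forall q, ev q kUV = gmf q U V) ->
  2 * gmf p (nabla U V) W
  = (ev p (U kVW) : R) + ev p (V kUW) - ev p (W kUV)
    + gmf p (vbr U V) W - gmf p (vbr U W) V - gmf p (vbr V W) U.
Proof.
move=> UU VV WW eVW eUW eUV; have [_ _ mc] := nabla_LC.
rewrite (mc U V W UU VV WW _ eVW) (mc V U W VV UU WW _ eUW) (mc W U V WW UU VV _ eUV).
rewrite -!gmf_torsion //.
rewrite (gmf_sym p VV (nabla_field UU WW)) (gmf_sym p UU (nabla_field VV WW)).
rewrite (gmf_sym p UU (nabla_field WW VV)).
move: (gmf p (nabla U V) W) (gmf p (nabla V U) W) (gmf p (nabla U W) V)
  (gmf p (nabla V W) U) (gmf p (nabla W U) V) (gmf p (nabla W V) U) => *; ring.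
Qed.

Hypothesis gm_inv : invariantMetric gm.

Lemma gmf_push a p U V : vf U -> vf V ->
  gmf (act a p) (pushV a U) (pushV a V) = gmf p U V.
Proof. by move=> UU VV; rewrite !at_pt_push gm_inv //; exact: vfield_tangent. Qed.

(** An isometry carries every term of the Koszul formula to the corresponding
    term for the pushed fields, and the formula determines the connection. *)
Lemma leviCivita_invariant : invariantConnection nabla.
Proof.
move=> a V W VV WW f; congr (_ f).
have pf U : vf U -> vf (pushV a U) by exact: pushV_field.
have [_ _ _ smooth] := gm_riem.
apply: vfield_ext => [||p U UU].
- exact/pf/nabla_field.
- by apply: nabla_field; exact: pf.
rewrite -(pushVKV a U); set U' := pushV a^-1%g U.
have UU' : vf U' by exact: pushV_field.
have [q ->] : exists q, p = act a q.
  by exists (act a^-1%g p); rewrite -actM mulgV act1.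
rewrite gmf_push //; last exact: nabla_field.
have [kVU eVU] := smooth _ _ WW UU'; have [kWU eWU] := smooth _ _ VV UU'.
have [kVW eVW] := smooth _ _ VV WW.
have pushk (k : C) A B : vf A -> vf B -> (forall q, ev q k = gmf q A B) ->
    forall q, ev q (transl a^-1%g k) = gmf q (pushV a A) (pushV a B).
  move=> AA BB e r; rewrite ev_transl e -(gmf_push a) //.
  by rewrite -actM mulgV act1.
have ev_push (k : C) A : ev (act a q) (pushV a A (transl a^-1%g k)) = ev q (A k).
  by rewrite /pushV translVK ev_transl -actM mulVg act1.
apply: (mulfI (x := 2)) => //.
rewrite (koszul q VV WW UU' eVU eWU eVW).
rewrite (koszul (act a q) (pf _ VV) (pf _ WW) (pf _ UU') (pushk _ _ _ WW UU' eVU)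
  (pushk _ _ _ VV UU' eWU) (pushk _ _ _ VV WW eVW)).
by rewrite !ev_push -!pushV_vbr !gmf_push //; exact: vbr_field.
Qed.

Definition form_orig (X Y : lie G) : R := gm (orig M) (tan_orig M X) (tan_orig M Y).

Lemma form_orig_sym X Y : form_orig X Y = form_orig Y X.
Proof. by apply: gmf_sym; exact: fund_field. Qed.

Lemma form_orig_linear_l Z : linear_for *%R (form_orig ^~ Z).
Proof.
move=> a X Y; have [lin _ _ _] := gm_riem.
rewrite /form_orig -lin; try exact: (vfield_tangent (orig M) (fund_field M _)).
by congr gm; apply/funext => f; rewrite /tan_orig /at_pt fund_linear evP.
Qed.

Lemma form_orig_linear_r Z : linear_for *%R (form_orig Z).
Proof. by move=> a X Y; rewrite !(form_orig_sym Z) form_orig_linear_l. Qed.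

Lemma form_orig_opp_l X Y : form_orig (- X) Y = - form_orig X Y.
Proof. exact: (linearN (functional (form_orig_linear_l Y))). Qed.

Lemma form_orig_opp_r X Y : form_orig X (- Y) = - form_orig X Y.
Proof. exact: (linearN (functional (form_orig_linear_r X))). Qed.

(** Fundamental fields are Killing fields.  By invariance, the value of the
    metric at [exp (tX) o] on two fundamental fields is the value at [o] on the
    fundamental fields of [Ad (exp tX)^-1 Y] and [Ad (exp tX)^-1 Z]; this turns
    the derivative into one of a bilinear form on the Lie algebra. *)
Lemma fund_form_derive X Y Z (k : C) :
  (forall p, ev p k = gmf p (fundM Y) (fundM Z)) ->
  ev (orig M) (fundM X k) = - form_orig (br X Y) Z - form_orig Y (br X Z).
Proof.
move=> ek.
pose c (t : R) (A : lie G) := Ad (expG (t *: X))^-1%g A.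
pose F t := functional (form_orig_linear_l (c t Z)).
pose F' := functional (form_orig_linear_l (- br X Z)).
have dF (A : lie G) : is_derive (0 : R^o) 1 (fun t : R^o => F t A) (F' A).
  exact: (Ad_curveV X Z (functional (form_orig_linear_r A))).
have := derive_pairing (Ad_curveV X Y) dF.
have -> : (fun t : R^o => F t (Ad (expG (t *: X))^-1%g Y)) =
          (fun t : R^o => ev (act (expG (t *: X)) (orig M)) k).
  apply/funext => t; rewrite ek /F /= /form_orig /c.
  set a := expG _; rewrite -[in RHS](AdKV a Y) -[in RHS](AdKV a Z).
  by rewrite !(fund_push _ a) gmf_push //; exact: fund_field.
move/(is_derive_unique (fund_derive X k (orig M))) => ->.
rewrite /F /F' /= /c scale0r expG0 invg1 !Ad1.
by rewrite form_orig_opp_l form_orig_opp_r.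
Qed.

(** The Koszul formula for fundamental fields: the derivatives of the metric are
    given by [fund_form_derive], the Lie brackets by [vbr_fund].  What remains
    involves only the Lie bracket and the form at the base point. *)
Lemma nomizu_koszul X Y Z :
  2 * gm (orig M) (fun f => ev (orig M) (nabla (fundM X) (fundM Y) f)
                           - ev (orig M) (vbr (fundM X) (fundM Y) f))
                  (tan_orig M Z)
  = form_orig (br X Y) Z + form_orig (br Z X) Y + form_orig X (br Z Y).
Proof.
have ff := fund_field M.
have [_ _ _ smooth] := gm_riem.
have [kYZ eYZ] := smooth _ _ (ff Y) (ff Z).
have [kXZ eXZ] := smooth _ _ (ff X) (ff Z).
have [kXY eXY] := smooth _ _ (ff X) (ff Y).
rewrite [gm _ _ _](gmfB (orig M)) //; last 2 first.
- exact: nabla_field.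
- exact: vbr_field.
rewrite mulrBr (koszul _ _ _ _ eYZ eXZ eXY) //.
rewrite (fund_form_derive _ eYZ) (fund_form_derive _ eXZ) (fund_form_derive _ eXY).
rewrite !vbr_fund -![gm _ _ _]/(form_orig _ _).
rewrite (br_anti Y X) (br_anti X Z) (br_anti Y Z).
rewrite !(form_orig_opp_l, form_orig_opp_r).
rewrite (form_orig_sym X (br Z Y)) (form_orig_sym Y (br Z X)).
ring.
Qed.

End LeviCivita.
End RiemannianGeometry.

(** * The Lie algebra su(2) *)

Section SU2.
Variable R : realType.
Local Notation C := R[i].

Lemma mx2P (A : 'M[C]_2) : A = mx2 (A 0 0) (A 0 1) (A 1 0) (A 1 1).
Proof.
by apply/matrixP => i j; rewrite mxE;
  case: i => [[|[|]]] //= ?; case: j => [[|[|]]] //= ?; congr (A _ _); apply/val_inj.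
Qed.

Lemma mulmx2 (a b c d a' b' c' d' : C) :
  mx2 a b c d *m mx2 a' b' c' d' =
  mx2 (a * a' + b * c') (a * b' + b * d') (c * a' + d * c') (c * b' + d * d').
Proof.
by apply/matrixP => i j; rewrite !mxE !big_ord_recl big_ord0 !mxE addr0;
  case: i => [[|[|]]] //= ?; case: j => [[|[|]]] //= ?.
Qed.

Lemma addmx2 (a b c d a' b' c' d' : C) :
  mx2 a b c d + mx2 a' b' c' d' = mx2 (a + a') (b + b') (c + c') (d + d').
Proof.
by apply/matrixP => i j; rewrite !mxE;
  case: i => [[|[|]]] //= ?; case: j => [[|[|]]] //= ?.
Qed.

Lemma oppmx2 (a b c d : C) : - mx2 a b c d = mx2 (- a) (- b) (- c) (- d).
Proof.
by apply/matrixP => i j; rewrite !mxE;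
  case: i => [[|[|]]] //= ?; case: j => [[|[|]]] //= ?.
Qed.

Lemma scalemx2 (k a b c d : C) : k *: mx2 a b c d = mx2 (k * a) (k * b) (k * c) (k * d).
Proof.
by apply/matrixP => i j; rewrite !mxE;
  case: i => [[|[|]]] //= ?; case: j => [[|[|]]] //= ?.
Qed.

Lemma adjmx2 (a b c d : C) :
  adjmx (mx2 a b c d) = mx2 (conjc a) (conjc c) (conjc b) (conjc d).
Proof.
by apply/matrixP => i j; rewrite !mxE;
  case: i => [[|[|]]] //= ?; case: j => [[|[|]]] //= ?.
Qed.

Lemma su2_0 : su2 (0 : 'M[C]_2).
Proof.
split; last exact: mxtrace0.
by apply/matrixP => i j; rewrite !mxE oppr0 rmorph0.
Qed.

Lemma su2_comb (x : R) (A B : 'M[C]_2) : su2 A -> su2 B -> su2 (x%:C *: A + B).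
Proof.
move=> [AA At] [BB Bt]; split; last by rewrite mxtraceD mxtraceZ At Bt mulr0 addr0.
rewrite opprD -scalerN -AA -BB; apply/matrixP => i j.
by rewrite !mxE rmorphD rmorphM /= oppr0.
Qed.

Lemma su2_sigma k : su2 (sigma R k).
Proof.
split; rewrite /sigma.
  do 2?case: ifP => _; rewrite adjmx2 oppmx2; congr mx2; apply/eqP;
    by rewrite eq_complex /= ?oppr0 ?opprK !eqxx.
do 2?case: ifP => _; by rewrite /mxtrace !big_ord_recl big_ord0 !mxE /= ?addr0 ?subrr.
Qed.

(** The indices are cyclic, so this shows that every basis matrix is a
    multiple of a commutator. *)
Lemma sigma_comm (k : 'I_3) :
  sigma R (k + 1) *m sigma R (k + 2) - sigma R (k + 2) *m sigma R (k + 1)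
  = (2%:R : R)%:C *: sigma R k.
Proof.
case: k => [[|[|[|]]]] // ?; rewrite /sigma /= !mulmx2 oppmx2 addmx2 scalemx2;
  congr mx2; apply/eqP; rewrite eq_complex /=; apply/andP; split; apply/eqP; ring.
Qed.

Lemma su2_span A : su2 A -> exists x y z : R,
  A = x%:C *: sigma R 0 + (y%:C *: sigma R 1 + (z%:C *: sigma R 2 + 0)).
Proof.
case; rewrite (mx2P A); move: (A 0 0) (A 0 1) (A 1 0) (A 1 1).
move=> [a a'] [b b'] [c c'] [d d'].
rewrite adjmx2 oppmx2 /mxtrace !big_ord_recl big_ord0 !mxE /= addr0.
move=> /matrixP E tr0.
have [_ tr0'] : Complex (a + d) (a' + d') = Complex 0 0 by exact: tr0.
have [a0] : conjc (Complex a a') = - Complex a a' by have := E 0 0; rewrite !mxE.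
have [cb cb'] : conjc (Complex c c') = - Complex b b' by have := E 0 1; rewrite !mxE.
have [d0] : conjc (Complex d d') = - Complex d d' by have := E 1 1; rewrite !mxE.
exists a', c, (- c'); rewrite /sigma /= !scalemx2 addr0 !addmx2.
congr mx2; apply/eqP; rewrite eq_complex /=; apply/andP; split; apply/eqP; lra.
Qed.
End SU2.

(** * The reductive decomposition *)

Section SasakiData.
Variables (R : realType) (G : lieGroup R) (n : nat) (D : sasaki3Data G n).
Implicit Types (X Y Z : lie G) (a : G).

Lemma h_sub_g0 X : X \in h D -> X \in g0 D.
Proof. by rewrite -(g0_decomp D); exact: (subvP (addvSl _ _)). Qed.

Lemma sp1_sub_g0 X : X \in sp1 D -> X \in g0 D.
Proof. by rewrite -(g0_decomp D); exact: (subvP (addvSr _ _)). Qed.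

Lemma sp1_sub_m X : X \in sp1 D -> X \in m D.
Proof. exact: (subvP (addvSl _ _)). Qed.

Lemma g1_sub_m X : X \in g1 D -> X \in m D.
Proof. exact: (subvP (addvSr _ _)). Qed.

Lemma g0_g1_eq0 X : X \in g0 D -> X \in g1 D -> X = 0.
Proof.
by move=> X0 X1; apply/eqP; rewrite -memv0 -(g_direct D) memv_cap X0.
Qed.

Lemma sp1_g1_direct : (sp1 D :&: g1 D = 0)%VS.
Proof.
apply/eqP; rewrite -subv0; apply/subvP => X; rewrite memv_cap => /andP[XV XH].
by rewrite memv0 (g0_g1_eq0 (sp1_sub_g0 XV) XH).
Qed.

Lemma m_h_direct : (m D :&: h D = 0)%VS.
Proof.
apply/eqP; rewrite -subv0; apply/subvP => X; rewrite memv_cap => /andP[+ Xh].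
case/memv_addP => V VV [W WH XE].
have W0 : W = 0.
  apply: g0_g1_eq0 WH; rewrite (_ : W = X - V); last by rewrite XE addrC addKr.
  by apply: rpredB; [exact: h_sub_g0 | exact: sp1_sub_g0].
rewrite -(g0_direct D) memv_cap Xh /=; move: XE; rewrite W0 addr0 => -> //.
Qed.

Lemma m_h_full : (m D + h D)%VS = fullv.
Proof. by rewrite -(g_decomp D) -(g0_decomp D) addvC addvA. Qed.

Lemma pr_m_in X : pr_m D X \in m D.
Proof. exact: memv_pi. Qed.

Lemma pr_m_id X : X \in m D -> pr_m D X = X.
Proof. exact: (daddv_pi_id m_h_direct). Qed.

Lemma pr_m_sub X : X - pr_m D X \in h D.
Proof.
have := daddv_pi_add (w := X) m_h_direct; rewrite m_h_full memvf => /(_ isT).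
by move=> {1}<-; rewrite addrC addKr memv_pi.
Qed.

Definition pr_V : lie G -> lie G := daddv_pi (sp1 D) (g1 D).
Definition pr_H : lie G -> lie G := daddv_pi (g1 D) (sp1 D).

Lemma pr_V_in X : pr_V X \in sp1 D. Proof. exact: memv_pi. Qed.
Lemma pr_H_in X : pr_H X \in g1 D. Proof. exact: memv_pi. Qed.

Lemma pr_VH X : X \in m D -> X = pr_V X + pr_H X.
Proof. by move=> Xm; rewrite [RHS]daddv_pi_add // sp1_g1_direct. Qed.

Lemma pr_sp1 X : X \in sp1 D -> pr_V X = X /\ pr_H X = 0.
Proof.
move=> XV; have VX : pr_V X = X by exact: (daddv_pi_id sp1_g1_direct).
split=> //; have := pr_VH (sp1_sub_m XV); rewrite VX -{1}[X]addr0.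
by move/addrI.
Qed.

Lemma pr_g1 X : X \in g1 D -> pr_V X = 0 /\ pr_H X = X.
Proof.
move=> XH; have HX : pr_H X = X.
  by apply: daddv_pi_id => //; rewrite capvC sp1_g1_direct.
split=> //; have := pr_VH (g1_sub_m XH); rewrite HX addrC -{1}[X]addr0.
by move/addrI.
Qed.

Lemma br_sp1_g1 X Y : X \in sp1 D -> Y \in g1 D -> br X Y \in g1 D.
Proof. by move/sp1_sub_g0; have [_ + _ _] := g_graded D; apply. Qed.

Lemma br_g1_sp1 X Y : X \in g1 D -> Y \in sp1 D -> br X Y \in g1 D.
Proof. by move=> + /sp1_sub_g0; have [_ _ + _] := g_graded D; apply. Qed.

Lemma br_sp1_sp1 X Y : X \in sp1 D -> Y \in sp1 D -> br X Y \in sp1 D.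
Proof. by have [_ + _] := g0_lie D; apply. Qed.

Lemma br_g1_g1 X Y : X \in g1 D -> Y \in g1 D -> br X Y \in g0 D.
Proof. by have [_ _ _] := g_graded D; apply. Qed.

Lemma br_h_sp1 X Y : X \in h D -> Y \in sp1 D -> br X Y = 0.
Proof. by move=> Xh YV; have [_ _ /(_ _ _ Xh YV)] := g0_lie D; rewrite memv0 => /eqP. Qed.

(** [sp(1)] is perfect and commutes with [h], and
    [killing X [A, B] = killing [X, A] B]. *)
Lemma killing_h_sp1 X Y : X \in h D -> Y \in sp1 D -> killing X Y = 0.
Proof.
move=> Xh YV; have [lin iotaM _ im] := sp1_iso D.
have iotaV k : Defs.iota D (sigma R k) \in sp1 D.
  by apply/im; exists (sigma R k) => //; exact: su2_sigma.
have su20 := su2_0 R.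
have iota0 : Defs.iota D 0 = 0.
  have := lin 1 0 0 su20 su20; rewrite scaler0 addr0 scale1r -{1}[Defs.iota D 0]addr0.
  by move/addrI.
have killing0 k : killing X (Defs.iota D (sigma R k)) = 0.
  have comm : 2 *: Defs.iota D (sigma R k) =
      br (Defs.iota D (sigma R (k + 1))) (Defs.iota D (sigma R (k + 2))).
    rewrite -iotaM ?sigma_comm; try exact: su2_sigma.
    have := lin 2 _ _ (su2_sigma R k) su20; rewrite addr0 iota0 addr0 => <-.
    by [].
  have : killing X (2 *: Defs.iota D (sigma R k)) = 0.
    rewrite comm -killing_invariant br_h_sp1 //.
    exact: killing_0_l.
  rewrite killing_sym killing_scale_l killing_sym.
  by move/eqP; rewrite mulf_eq0 pnatr_eq0 /= => /eqP.
have /im [A suA <-] := YV; have [x [y [z ->]]] := su2_span suA.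
have sig := su2_sigma R.
rewrite !lin //; try by repeat apply: su2_comb.
rewrite iota0 addr0 killing_sym !(killing_add_l, killing_scale_l).
by rewrite ![killing _ X]killing_sym !killing0 !mulr0 !addr0.
Qed.

(** Generators [exp Y] of [H], with [Y] in [h], fix [sp(1)] pointwise because [Y]
    commutes with [sp(1)]. *)
Lemma Ad_H_sp1 a X : H D a -> X \in sp1 D -> Ad a X = X.
Proof.
rewrite (H_connected D) => Ha XV.
apply: (Ha [set b | Ad b X = X]) => [|Y Yh].
  split=> [|b c /= bX cX|b /= bX]; first exact: Ad1.
  - by rewrite AdM cX bX.
  - by rewrite -[in LHS]bX AdVK.
by apply: Ad_exp_fix; exact: br_h_sp1.
Qed.

(** [H] is fixed by [theta], so [Ad a] commutes with the differential of [theta]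
    and preserves its eigenspace [g1] for the eigenvalue [-1]. *)
Lemma Ad_H_g1 a X : H D a -> X \in g1 D -> Ad a X \in g1 D.
Proof.
move=> /(@H_sub _ _ _ D) G0a XH.
have [_ _ G0V] := G0_subgroup D.
have fix_a : theta D a = a := @G0_fix _ _ _ D a G0a.
have fix_aV : theta D a^-1%g = a^-1%g := @G0_fix _ _ _ D _ (G0V _ G0a).
have /memv_addP[Z0 Z0g [Z1 Z1g E]] : Ad a X \in (g0 D + g1 D)%VS.
  by rewrite (g_decomp D) memvf.
have Z00 : - Ad a X = Z0 - Z1.
  apply: expG_inj => t.
  rewrite scalerN scalerBr -(theta_exp (s := D)) ?rpredZ // -scalerDr -E.
  rewrite -linearZ -linearN /= !Ad_expG !thetaM fix_a fix_aV.
  by rewrite -[t *: X]add0r theta_exp ?rpred0 ?rpredZ // sub0r add0r.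
suff Z0_0 : Z0 = 0 by rewrite E Z0_0 add0r.
move/eqP: Z00; rewrite E opprD (addrC _ (- Z1)) (addrC Z0) (inj_eq (addrI _)).
rewrite eq_sym -addr_eq0 -mulr2n -scaler_nat scaler_eq0 pnatr_eq0 /=.
by move/eqP.
Qed.

Lemma Ad_H_m a X : H D a -> X \in m D -> Ad a X \in m D.
Proof.
move=> Ha Xm; rewrite (pr_VH Xm) linearD /= rpredD //.
  by rewrite (Ad_H_sp1 Ha) ?sp1_sub_m ?pr_V_in.
by rewrite g1_sub_m ?Ad_H_g1 ?pr_H_in.
Qed.

(** The four cases of the claim in one expression, with [q = alpha / delta]: the
    second summand turns the coefficient [1/2] of [[X, Y]] into [1 - q] when [X]
    is vertical and [Y] horizontal, and into [q] in the opposite case. *)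
Definition nomizu_formula (q : R) X Y : lie G :=
  2^-1 *: pr_m D (br X Y)
  + (2^-1 - q) *: (br (pr_V X) (pr_H Y) - br (pr_H X) (pr_V Y)).

Lemma pr_m_linear : linear (pr_m D). Proof. exact: linearP. Qed.
Lemma pr_V_linear : linear pr_V. Proof. exact: linearP. Qed.
Lemma pr_H_linear : linear pr_H. Proof. exact: linearP. Qed.

Lemma scale_sub_comb (V : lmodType R) (c s r : R) (u v x y z w : V) :
  s *: (c *: u + v) + r *: ((c *: x + y) - (c *: z + w))
  = c *: (s *: u + r *: (x - z)) + (s *: v + r *: (y - w)).
Proof.
rewrite opprD addrACA -scalerBr; move: (x - z) (y - w) => p t.
by rewrite !scalerDr !scalerA (mulrC s) (mulrC r) addrACA.
Qed.

Lemma nomizu_formula_linear_l q c X Y Z :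
  nomizu_formula q (c *: X + Y) Z
  = c *: nomizu_formula q X Z + nomizu_formula q Y Z.
Proof.
rewrite /nomizu_formula pr_V_linear pr_H_linear !br_linearl pr_m_linear.
exact: scale_sub_comb.
Qed.

Lemma nomizu_formula_linear_r q c X Y Z :
  nomizu_formula q Z (c *: X + Y)
  = c *: nomizu_formula q Z X + nomizu_formula q Z Y.
Proof.
rewrite /nomizu_formula pr_V_linear pr_H_linear !br_linearr pr_m_linear.
exact: scale_sub_comb.
Qed.

End SasakiData.

(** * The Nomizu map of the Levi-Civita connection *)

Section NomizuMap.
Variables (R : realType) (G : lieGroup R) (n : nat) (D : sasaki3Data G n).
Variables (alpha delta : R) (M : homSpace (H D)) (S : sasaki3Manifold alpha delta M).
Hypotheses (alpha0 : alpha != 0) (delta0 : delta != 0).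
Local Notation B := (form_orig (metric S)).
Implicit Types (X Y Z : lie G) (a : G).

Lemma form_add_l X Y Z : B (X + Y) Z = B X Z + B Y Z.
Proof.
by have := form_orig_linear_l (metric_riemannian S) Z 1 X Y; rewrite scale1r mul1r.
Qed.

Lemma form_0_l Z : B 0 Z = 0.
Proof.
exact: (linear0 (functional (form_orig_linear_l (metric_riemannian S) Z))).
Qed.

Lemma form_scale_l (c : R) X Z : B (c *: X) Z = c * B X Z.
Proof.
have := form_orig_linear_l (metric_riemannian S) Z c X 0.
by rewrite addr0 form_0_l addr0.
Qed.

Lemma form_sym X Y : B X Y = B Y X.
Proof. exact: form_orig_sym (metric_riemannian S) X Y. Qed.

Lemma form_opp_l X Y : B (- X) Y = - B X Y.
Proof. exact: form_orig_opp_l (metric_riemannian S) X Y. Qed.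

Lemma form_add_r X Y Z : B Z (X + Y) = B Z X + B Z Y.
Proof. by rewrite !(form_sym Z) form_add_l. Qed.

(** The isotropy algebra of the base point is [h]. *)
Lemma tan_orig_eq0 X : tan_orig M X = (fun=> 0) <-> X \in h D.
Proof.
have HX : lieOf (H D) X = (X \in h D) by rewrite H_lie.
rewrite -HX -(fund_orig M X); split=> [E f | E].
  by have /(congr1 (@^~ f)) := E.
by apply/funext => f; exact: E.
Qed.

Lemma tan_orig_sub X Y :
  tan_orig M (X - Y) = (fun f => tan_orig M X f - tan_orig M Y f).
Proof.
apply/funext => f; rewrite /tan_orig /at_pt.
have := fund_linear (h := M) (-1) Y X f; rewrite !scaleN1r addrC => ->.
by rewrite addrC evB.
Qed.

Lemma tan_orig_eq X Y : tan_orig M X = tan_orig M Y <-> X - Y \in h D.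
Proof.
rewrite -tan_orig_eq0 tan_orig_sub; split=> [-> | E].
  by apply/funext => f; rewrite subrr.
apply/funext => f; have /(congr1 (@^~ f)) := E.
by move/eqP; rewrite subr_eq0 => /eqP.
Qed.

Lemma tan_orig_inj X Y : X \in m D -> Y \in m D ->
  tan_orig M X = tan_orig M Y -> X = Y.
Proof.
move=> Xm Ym /tan_orig_eq XYh; apply/eqP; rewrite -subr_eq0 -memv0.
by rewrite -(m_h_direct D) memv_cap XYh rpredB.
Qed.

Lemma tan_orig_pr_m X : tan_orig M (pr_m D X) = tan_orig M X.
Proof. by apply/esym/tan_orig_eq; exact: pr_m_sub. Qed.

Lemma form_pr_m X Y : B (pr_m D X) Y = B X Y.
Proof. by rewrite /form_orig tan_orig_pr_m. Qed.

Lemma form_h X Y : X \in h D -> B X Y = 0.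
Proof.
move=> Xh; have X0 : tan_orig M X = tan_orig M 0 by apply/tan_orig_eq; rewrite subr0.
by rewrite /form_orig X0; exact: form_0_l.
Qed.

Lemma form_sp1_g1 X Y : X \in sp1 D -> Y \in g1 D -> B X Y = 0.
Proof. exact: metric_VH. Qed.

Lemma form_g0_g1 X Y : X \in g0 D -> Y \in g1 D -> B X Y = 0.
Proof.
rewrite -(g0_decomp D) => /memv_addP[A Ah [V VV ->]] YH.
by rewrite form_add_l form_h // form_sp1_g1 // addr0.
Qed.

Lemma form_g1_g0 X Y : X \in g1 D -> Y \in g0 D -> B X Y = 0.
Proof. by move=> XH Y0; rewrite form_sym form_g0_g1. Qed.

Definition killing_coef_V : R := - (4 * delta ^+ 2 * (n%:R + 2))^-1.
Definition killing_coef_H : R := - (8 * alpha * delta * (n%:R + 2))^-1.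

(** Vertical and horizontal vectors are normalised by different multiples of the
    Killing form; their ratio is what deforms the coefficient [1/2]. *)
Lemma killing_coef_VH : killing_coef_V = 2 * (alpha / delta) * killing_coef_H.
Proof.
have n0 : n%:R + 2 != 0 :> R by rewrite -natrD pnatr_eq0 addn2.
by rewrite /killing_coef_V /killing_coef_H; field; rewrite n0 alpha0 delta0.
Qed.

Lemma form_g0_sp1 X Y : X \in g0 D -> Y \in sp1 D -> B X Y = killing_coef_V * killing X Y.
Proof.
rewrite -(g0_decomp D) => /memv_addP[A Ah [V VV ->]] YV.
rewrite form_add_l form_h // add0r killing_add_l (killing_h_sp1 Ah YV) add0r.
by rewrite /form_orig metric_V // /killing_coef_V mulNr mulrC mulNr.
Qed.

Lemma form_g1_g1 X Y : X \in g1 D -> Y \in g1 D -> B X Y = killing_coef_H * killing X Y.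
Proof.
by move=> XH YH; rewrite /form_orig metric_H // /killing_coef_H mulNr mulrC mulNr.
Qed.

Lemma killing_cycle X Y Z : killing (br Z X) Y = killing (br X Y) Z.
Proof. by rewrite killing_invariant killing_sym. Qed.

Let defect := 1 - 2 * (alpha / delta).

(** The failure of [ad Z] to be skew for the invariant form.  Terms with an odd
    number of entries in [g1] vanish; where only one normalisation of the
    Killing form occurs, its invariance makes the terms cancel; they survive,
    with factor [killing_coef_H - killing_coef_V = defect * killing_coef_H],
    exactly when [Z] is horizontal and one of [X], [Y] is vertical, the other
    horizontal. *)
Lemma form_defect_split Xv Xh Yv Yh Zv Zh :
  Xv \in sp1 D -> Xh \in g1 D -> Yv \in sp1 D -> Yh \in g1 D ->
  Zv \in sp1 D -> Zh \in g1 D ->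
  B (br (Zv + Zh) (Xv + Xh)) (Yv + Yh) + B (Xv + Xh) (br (Zv + Zh) (Yv + Yh))
  = defect * B (br Xv Yh - br Xh Yv) (Zv + Zh).
Proof.
move=> Xvin Xhin Yvin Yhin Zvin Zhin.
have VV := @br_sp1_sp1 _ _ _ D; have VH := @br_sp1_g1 _ _ _ D.
have HV := @br_g1_sp1 _ _ _ D; have HH := @br_g1_g1 _ _ _ D.
have V0 := @sp1_sub_g0 _ _ _ D.
have skew (A A' C : lie G) : killing (br C A') A = - killing (br A A') C.
  by rewrite killing_cycle (br_anti A') killing_opp_l.
rewrite !br_add_l !linearD /= !(form_add_l, form_add_r, form_opp_l) !(form_sym Xv) !(form_sym Xh).
rewrite (form_sp1_g1 (VV _ _ Zvin Xvin) Yhin) (form_g1_g0 (VH _ _ Zvin Xhin) (V0 _ Yvin)).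
rewrite (form_g1_g0 (HV _ _ Zhin Xvin) (V0 _ Yvin)) (form_g0_g1 (HH _ _ Zhin Xhin) Yhin).
rewrite (form_sp1_g1 (VV _ _ Zvin Yvin) Xhin) (form_g1_g0 (VH _ _ Zvin Yhin) (V0 _ Xvin)).
rewrite (form_g1_g0 (HV _ _ Zhin Yvin) (V0 _ Xvin)) (form_g0_g1 (HH _ _ Zhin Yhin) Xhin).
rewrite (form_g1_g0 (VH _ _ Xvin Yhin) (V0 _ Zvin)) (form_g1_g0 (HV _ _ Xhin Yvin) (V0 _ Zvin)).
rewrite (form_g0_sp1 (V0 _ (VV _ _ Zvin Xvin)) Yvin).
rewrite (form_g0_sp1 (V0 _ (VV _ _ Zvin Yvin)) Xvin).
rewrite (form_g1_g1 (VH _ _ Zvin Xhin) Yhin) (form_g1_g1 (VH _ _ Zvin Yhin) Xhin).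
rewrite (form_g1_g1 (HV _ _ Zhin Xvin) Yhin) (form_g0_sp1 (HH _ _ Zhin Yhin) Xvin).
rewrite (form_g0_sp1 (HH _ _ Zhin Xhin) Yvin) (form_g1_g1 (HV _ _ Zhin Yvin) Xhin).
rewrite (form_g1_g1 (VH _ _ Xvin Yhin) Zhin) (form_g1_g1 (HV _ _ Xhin Yvin) Zhin).
rewrite (killing_cycle Xv Yv) (killing_cycle Xh Yh).
rewrite (killing_cycle Xv Yh) (killing_cycle Xh Yv).
rewrite !(skew Xv) !(skew Xh) killing_coef_VH /defect; ring.
Qed.

Lemma form_defect X Y Z : X \in m D -> Y \in m D -> Z \in m D ->
  B (br Z X) Y + B X (br Z Y)
  = defect * B (br (pr_V D X) (pr_H D Y) - br (pr_H D X) (pr_V D Y)) Z.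
Proof.
move=> Xm Ym Zm.
have := form_defect_split (pr_V_in D X) (pr_H_in D X) (pr_V_in D Y) (pr_H_in D Y)
  (pr_V_in D Z) (pr_H_in D Z).
by rewrite -!pr_VH.
Qed.

Local Notation Lam := (nomizu_formula D (alpha / delta)).

Lemma nomizu_formula_in_m X Y : Lam X Y \in m D.
Proof.
apply: rpredD; apply: rpredZ; first exact: pr_m_in.
apply/g1_sub_m/rpredB; last exact: br_g1_sp1 (pr_H_in D X) (pr_V_in D Y).
exact: br_sp1_g1 (pr_V_in D X) (pr_H_in D Y).
Qed.

(** The formula satisfies the same equation as the Nomizu map of the Levi-Civita
    connection in [nomizu_koszul]. *)
Lemma nomizu_formula_form X Y Z : X \in m D -> Y \in m D -> Z \in m D ->
  2 * B (Lam X Y) Z = B (br X Y) Z + B (br Z X) Y + B X (br Z Y).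
Proof.
move=> Xm Ym Zm; rewrite -addrA form_defect //.
rewrite (form_add_l (_ *: pr_m _ _)) !form_scale_l form_pr_m /defect.
by field.
Qed.

Section Connection.
Variable nabla : (Cinf M -> Cinf M) -> (Cinf M -> Cinf M) -> (Cinf M -> Cinf M).
Hypothesis LC : leviCivita (metric S) nabla.
Local Notation fundM := (fund (h := M)).

(** Every tangent vector at the base point is some [tan_orig M Z0], and the form
    pairs [Z0] and the formula equally with everything; so they agree modulo the
    kernel [h] of the form. *)
Lemma tan_orig_nomizu_formula X Y : X \in m D -> Y \in m D ->
  tan_orig M (Lam X Y) =
  (fun f => ev (orig M) (nabla (fundM X) (fundM Y) f)
            - ev (orig M) (vbr (fundM X) (fundM Y) f)).
Proof.
move=> Xm Ym; set v := RHS.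
have riem := metric_riemannian S.
have fN : vectorField (fun f => nabla (fundM X) (fundM Y) f - vbr (fundM X) (fundM Y) f).
  apply: vfieldB; first by apply: (nabla_field LC); exact: fund_field.
  by apply: vbr_field; exact: fund_field.
have vE : v = at_pt (orig M)
    (fun f => nabla (fundM X) (fundM Y) f - vbr (fundM X) (fundM Y) f).
  by apply/funext => f; rewrite /at_pt evB.
have [Z0 Z0E] := tangent_orig (vfield_tangent (orig M) fN).
have {}Z0E : v = tan_orig M Z0 by rewrite vE.
have B0 Z : B (Lam X Y - Z0) Z = 0.
  rewrite form_sym -form_pr_m form_sym form_add_l form_opp_l; apply/eqP; rewrite subr_eq0; apply/eqP.
  apply: (mulfI (x := 2)) => //; rewrite nomizu_formula_form // ?pr_m_in //.
  rewrite -(nomizu_koszul riem LC (metric_invariant S)) -/v Z0E.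
  by [].
rewrite Z0E; apply/tan_orig_eq/tan_orig_eq0.
apply: (gm_nondegenerate riem); last exact: B0.
exact: (vfield_tangent (orig M) (fund_field M _)).
Qed.

(** [H] fixes the base point and the connection is invariant, so both sides
    represent the same tangent vector; both lie in the complement [m] of [h]. *)
Lemma nomizu_formula_equivariant a X Y : H D a -> X \in m D -> Y \in m D ->
  Lam (Ad a X) (Ad a Y) = Ad a (Lam X Y).
Proof.
move=> Ha Xm Ym.
have inv := leviCivita_invariant (metric_riemannian S) LC (metric_invariant S).
have ao : act a (orig M) = orig M.
  by have : [set b | act b (orig M) = orig M] a by rewrite act_stab.
apply: tan_orig_inj; rewrite ?nomizu_formula_in_m ?Ad_H_m ?nomizu_formula_in_m //.
have -> : tan_orig M (Ad a (Lam X Y)) = pushT a (tan_orig M (Lam X Y)).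
  by rewrite /tan_orig -fund_push_at ao.
rewrite !tan_orig_nomizu_formula ?Ad_H_m //; apply/funext => f; rewrite /pushT !fund_push.
rewrite -(inv a _ _ (fund_field M X) (fund_field M Y)) -pushV_vbr.
have push_o V : ev (orig M) (pushV a V f) = ev (orig M) (V (transl a f)).
  by rewrite -[in LHS]ao -[LHS]/(at_pt (act a (orig M)) (pushV a V) f) at_pt_push.
by rewrite !push_o.
Qed.

End Connection.
End NomizuMap.

Theorem proposition4p2p2 (R : realType) (G : lieGroup R) (n : nat)
    (D : sasaki3Data G n) (alpha delta : R) (M : homSpace (H D))
    (S : sasaki3Manifold alpha delta M)
    (nabla : (Cinf M -> Cinf M) -> (Cinf M -> Cinf M) -> (Cinf M -> Cinf M)) :
  alpha != 0 -> delta != 0 ->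
  (compactType G /\ 0 < alpha * delta) \/
    (noncompactType D /\ alpha * delta < 0) ->
  leviCivita (metric S) nabla ->
  invariantConnection nabla /\
  exists2 Lam : lie G -> lie G -> lie G,
    nomizuMap (m D) nabla Lam &
    [/\ forall X Y, X \in sp1 D -> Y \in sp1 D ->
          Lam X Y = 2^-1 *: pr_m D (br X Y),
        forall X Y, X \in g1 D -> Y \in g1 D ->
          Lam X Y = 2^-1 *: pr_m D (br X Y),
        forall X Y, X \in sp1 D -> Y \in g1 D ->
          Lam X Y = (1 - alpha / delta) *: br X Y
      & forall X Y, X \in g1 D -> Y \in sp1 D ->
          Lam X Y = (alpha / delta) *: br X Y].
Proof.
move=> alpha0 delta0 _ LC; split.
  exact: (leviCivita_invariant (metric_riemannian S) LC (metric_invariant S)).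
have br0l (Y : lie G) : br 0 Y = 0 by rewrite br_anti linear0 oppr0.
exists (nomizu_formula D (alpha / delta)).
  split=> [X Y _ _ | c X Y Z _ _ _ | a X Y Ha Xm Ym | X Y Xm Ym f].
  - exact: nomizu_formula_in_m.
  - by split; [exact: nomizu_formula_linear_l | exact: nomizu_formula_linear_r].
  - exact: (nomizu_formula_equivariant alpha0 delta0 LC).
  - by rewrite (tan_orig_nomizu_formula alpha0 delta0 LC Xm Ym).
split=> X Y XU YU; rewrite /nomizu_formula.
- have [-> ->] := pr_sp1 XU; have [-> ->] := pr_sp1 YU.
  by rewrite linear0 br0l subrr scaler0 addr0.
- have [-> ->] := pr_g1 XU; have [-> ->] := pr_g1 YU.
  by rewrite linear0 br0l subrr scaler0 addr0.
- have [-> ->] := pr_sp1 XU; have [-> ->] := pr_g1 YU.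
  rewrite br0l subr0 pr_m_id ?g1_sub_m ?br_sp1_g1 // -scalerDl.
  by congr (_ *: _); field.
- have [-> ->] := pr_g1 XU; have [-> ->] := pr_sp1 YU.
  rewrite br0l sub0r pr_m_id ?g1_sub_m ?br_g1_sp1 // scalerN -scalerBl.
  by congr (_ *: _); rewrite opprB addrC subrK.
Qed.
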